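(* Let $4.2$ denote the $3$-graph on $4$ vertices with exactly $2$ edges, $K_4^-$ the $3$-graph on $4$ vertices with exactly $3$ edges, $C_5$ the $3$-graph on $\{1,\dots,5\}$ with edges $123,234,345,451,512$, and $F_{3,2}$ the $3$-graph on $\{1,\dots,5\}$ with edges $123,124,125,345$. Then \[\pi_{4.2}(\{K_4^-,C_5,F_{3,2}\})=\frac{4}{9}.\]
   Context: A $3$-graph is a pair $G=(V,E)$ with $E$ a set of $3$-element subsets of $V$. For a $3$-graph $H$ on $h$ vertices and a $3$-graph $G$ on $n\ge h$ vertices, $e_H(G)$ is the number of $h$-subsets of $V(G)$ inducing a subgraph isomorphic to $H$. For a family $\mathcal{F}$ of $3$-graphs, $G$ is $\mathcal{F}$-free if it contains no member of $\mathcal{F}$ as a (not necessarily induced) subgraph. $\mathrm{ex}_H(n,\mathcal{F})$ is the maximum of $e_H(G)$ over $\mathcal{F}$-free $G$ on $n$ vertices, and $\pi_H(\mathcal{F})=\lim_{n\to\infty}\mathrm{ex}_H(n,\mathcal{F})/\binom{n}{h}$ (the limit exists). *)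

(* Defs.v *)
From HB Require Import structures.
From mathcomp Require Import all_boot all_order all_algebra.
From mathcomp Require Import all_classical all_reals all_analysis.
Set Implicit Arguments.
Unset Strict Implicit.
Unset Printing Implicit Defensive.
Import Order.TTheory GRing.Theory Num.Theory.
Import numFieldNormedType.Exports.

Record three_graph (V : finType) := ThreeGraph {
  edges :> {set {set V}};
  _ : [forall e in edges, #|e| == 3] }.

HB.instance Definition _ (V : finType) := [isSub for @edges V].
HB.instance Definition _ (V : finType) := [Finite of three_graph V by <:].

Definition isomorphic (V W : finType) (H : three_graph V) (G : three_graph W) :
    Prop :=
  exists2 f : V -> W, bijective f &
    forall e : {set V}, (e \in edges H) = (f @: e \in edges G).

(* The copy of H in G need not be induced. *)
Definition contains (V W : finType) (G : three_graph W) (H : three_graph V) :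
    Prop :=
  exists2 f : V -> W, injective f &
    forall e : {set V}, e \in edges H -> f @: e \in edges G.

Section Induced.
Variables (V : finType) (G : three_graph V) (S : {set V}).

Definition induced_edges : {set {set {x : V | x \in S}}} :=
  [set e : {set {x : V | x \in S}} | val @: e \in edges G].

Lemma induced_edgesP : [forall e in induced_edges, #|e| == 3].
Proof.
apply/forall_inP => e; rewrite inE => eG.
case: G eG => E /= /forall_inP EP /EP.
by rewrite card_imset //; exact: val_inj.
Qed.

Definition induced : three_graph {x : V | x \in S} := ThreeGraph induced_edgesP.
End Induced.

Definition num_induced (h : nat) (H : three_graph 'I_h) (V : finType)
    (G : three_graph V) : nat :=
  #|[set S : {set V} | (#|S| == h) && `[< isomorphic H (induced G S) >]]|.

Definition graph_family := set {k : nat & three_graph 'I_k}.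

Definition member (k : nat) (F : three_graph 'I_k) :
    {k : nat & three_graph 'I_k} :=
  Tagged (fun k => three_graph 'I_k) F.

Definition family_free (Fs : graph_family) (V : finType) (G : three_graph V) : Prop :=
  forall (k : nat) (F : three_graph 'I_k), Fs (member F) -> ~ contains G F.

Definition ex_num (h : nat) (H : three_graph 'I_h) (n : nat) (Fs : graph_family) : nat :=
  \max_(G : three_graph 'I_n | `[< family_free Fs G >]) num_induced H G.

Definition ex_ratio (R : realType) (h : nat) (H : three_graph 'I_h)
    (Fs : graph_family) (n : nat) : R :=
  ((ex_num H n Fs)%:R / 'C(n, h)%:R)%R.

Definition turan_density (R : realType) (h : nat) (H : three_graph 'I_h)
    (Fs : graph_family) : R :=
  limn (ex_ratio R H Fs).

(* Concrete 3-graphs are given by triples of labels in {1, ..., n}; the label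
   i stands for the element i - 1 of 'I_n. *)
Section OfTriples.
Variable n : nat.

Definition triple (t : nat * nat * nat) : {set 'I_n.+1} :=
  let: (a, b, c) := t in [set inord a.-1; inord b.-1; inord c.-1].

Definition triple_ok (t : nat * nat * nat) : bool :=
  let: (a, b, c) := t in
  uniq [:: a; b; c] && all (fun i => 0 < i <= n.+1) [:: a; b; c].

Lemma card_triple t : triple_ok t -> #|triple t| == 3.
Proof.
case: t => [[a b] c] /=; rewrite !inE negb_or !andbT.
case/andP=> /andP[/andP[ab ac] bc] /and3P[].
case: a ab ac => // a ab ac; case: b ab bc => // b ab bc.
case: c ac bc => // c ac bc /= an bn cn.
have neq i j : i < n.+1 -> j < n.+1 -> i.+1 != j.+1 ->
    (inord i : 'I_n.+1) != inord j.
  by move=> iN jN; rewrite -val_eqE /= !inordK.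
rewrite finset.setUC cardsU1 cards2 !finset.inE negb_or.
by rewrite !neq // eq_sym.
Qed.

Lemma triples_edgesP (s : seq (nat * nat * nat)) : all triple_ok s ->
  [forall e in [set e | e \in map triple s], #|e| == 3].
Proof.
move=> /allP ok; apply/forall_inP => e; rewrite inE => /mapP[t ts ->].
exact/card_triple/ok.
Qed.

Definition of_triples (s : seq (nat * nat * nat)) (ok : all triple_ok s) :
  three_graph 'I_n.+1 := ThreeGraph (triples_edgesP ok).
End OfTriples.

Definition G42 : three_graph 'I_4 :=
  @of_triples 3 [:: (1, 2, 3); (1, 2, 4)] isT.

Definition K4minus : three_graph 'I_4 :=
  @of_triples 3 [:: (1, 2, 3); (1, 2, 4); (1, 3, 4)] isT.

Definition C5 : three_graph 'I_5 :=
  @of_triples 4 [:: (1, 2, 3); (2, 3, 4); (3, 4, 5); (4, 5, 1); (5, 1, 2)] isT.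

Definition F32 : three_graph 'I_5 :=
  @of_triples 4 [:: (1, 2, 3); (1, 2, 4); (1, 2, 5); (3, 4, 5)] isT.

Definition forbidden : graph_family :=
  [set member K4minus; member C5; member F32]%classic.

(* Main.v *)
(* Every member of the forbidden family covers all pairs of its vertices, so
   the relation "xyz is an edge" of a free 3-graph avoids them on all tuples of
   vertices, repetitions included, and no error terms occur.  An induced 4.2 is
   a pair of edges xyz, xyw, and the number T of such (x, y, z, w) satisfies
   T <= (2/27) n^4.  This is a flag-algebra bound: for an explicit polynomial
   in the edge indicators of six vertices, the sum over all 6-tuples of
     2/27 - [xyz and xyw are edges] - (a combination of squares)
   is nonnegative, because its symmetrisation under S_6 is nonnegative on each
   of the finitely many free patterns on six labels.  Hence
   54 e_{4.2}(G) <= n^4, and the balanced complete tripartite 3-graph attains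
   this asymptotically. *)
Require Import Defs.
From Stdlib Require Import BinInt.
From HB Require Import structures.
From mathcomp Require Import all_boot all_order all_algebra.
From mathcomp Require Import all_classical all_reals all_analysis.
From mathcomp Require Import zify ssrZ ring lra.
Set Implicit Arguments.
Unset Strict Implicit.
Unset Printing Implicit Defensive.
Import Order.TTheory GRing.Theory Num.Theory.
Import numFieldNormedType.Exports.

(** * Free triple relations and the certificate *)

Definition triple_rel (T : Type) := T -> T -> T -> bool.

Record free_rel (T : Type) (c : triple_rel T) : Prop := FreeRel {
  free_rel12 : forall x y z, c x y z = c y x z;
  free_rel23 : forall x y z, c x y z = c x z y;
  free_rel_irr : forall x y, c x x y = false;
  free_relK4 : forall x y z w, c x y z -> c x y w -> c x z w = false;
  free_relC5 : forall x y z w v,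
    c x y z -> c y z w -> c z w v -> c w v x -> c v x y = false;
  free_relF32 : forall x y z w v,
    c x y z -> c x y w -> c x y v -> c z w v = false }.

Definition pullback (S T : Type) (f : S -> T) (c : triple_rel T) :
  triple_rel S := fun i j k => c (f i) (f j) (f k).

(** No axiom of [free_rel] asks for distinct arguments, so [f] may be any map, in particular a
    6-tuple with repeated vertices. *)
Lemma free_rel_pullback (S T : Type) (f : S -> T) (c : triple_rel T) :
  free_rel c -> free_rel (pullback f c).
Proof.
rewrite /pullback => -[s12 s23 irr k4 c5 f32].
split=> [x y z|x y z|x y|x y z w|x y z w v|x y z w v].
- exact: s12.
- exact: s23.
- exact: irr.
- exact: k4.
- exact: c5.
- exact: f32.
Qed.

(* The [pairform]s are combinations of flags rooted at the pair [x y], the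
   [quadform]s of flags rooted at a labelled 4.2 with edges [xyz], [xyw].  The
   coefficients come from rounding a numerical solution of the flag-algebra
   semidefinite program, after restricting to forms that vanish on the
   complete tripartite limit. *)
Section Certificate.
Variables (T : Type) (c : triple_rel T).
Implicit Types x y z w u v : T.
Local Open Scope Z_scope.

Definition ind (b : bool) : Z := if b then 1 else 0.

Definition pairform1 x y u v : Z :=
  let t := ind (c x u v) + ind (c y u v) in
  (if c x y u then 50 - 7 * t - (if c x y v then 28 else 0) else 0)
    - 27 * t + (if c x u v && c y u v then 54 else 0).

Definition pairform2 x y u v : Z :=
  let t := ind (c x u v) + ind (c y u v) in
  (if c x y u then 14 * t - 27 + (if c x y v then 53 else 0) else 0)
    + 18 * t - 8.

Definition pairform3 x y u v : Z :=
  let t := ind (c x u v) - ind (c y u v) in if c x y u then - t else 3 * t.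

Definition pairform4 x y u v : Z :=
  if c x y u then ind (c x u v) - ind (c y u v) else 0.

Definition quadform1 x y z w u : Z :=
  let t := ind (c x z u) - ind (c x w u) + ind (c y z u) - ind (c y w u) in
  if c z w u then t else 2 * t.

(** For symmetric [c], this and [link_cross] change sign under exchanging [x], [y] and under
    exchanging [z], [w], whereas [quadform1] is even in [x], [y] and odd in [z], [w]: the forms are
    sorted by symmetry type. *)
Definition link_diff x y z w u : Z :=
  ind (c x z u) - ind (c x w u) - ind (c y z u) + ind (c y w u).

Definition link_cross x y z w u : Z :=
  ind (c x z u && c y w u) - ind (c x w u && c y z u).

Definition quadform2 x y z w u : Z :=
  (if c z w u then 1 else -5) * link_diff x y z w u
    + 12 * link_cross x y z w u.

Definition quadform3 x y z w u : Z :=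
  2 * link_diff x y z w u + link_cross x y z w u.

(** In each product one factor depends on [z w] and the other on [u v], so for fixed [x y] the sum
    over both pairs is a positive combination of squares. In [quad_part] the vertices [u] and [v]
    are separated in the same way. *)
Definition pair_part x y z w u v : Z :=
  47 * (pairform1 x y z w * pairform1 x y u v)
  + 121 * (pairform2 x y z w * pairform2 x y u v)
  + 13200 * (pairform3 x y z w * pairform3 x y u v)
  + 69168 * (pairform4 x y z w * pairform4 x y u v).

Definition quad_part x y z w u v : Z :=
  72600 * (quadform1 x y z w u * quadform1 x y z w v)
  + 7128 * (quadform2 x y z w u * quadform2 x y z w v)
  + 18216 * (quadform3 x y z w u * quadform3 x y z w v).

(* Note that 69696 / 940896 = 2 / 27. *)
Definition slack x y z w u v : Z :=
  69696 - 9 * pair_part x y z w u v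
  - (if c x y z && c x y w then 940896 + 9 * quad_part x y z w u v else 0).

End Certificate.

(** * Symmetrisation over the permutations of six labels *)

Definition perms6 : seq (seq nat) := permutations (iota 0 6).

Definition slack_at (T : Type) (c : triple_rel T) (f : nat -> T) : Z :=
  slack c (f 0) (f 1) (f 2) (f 3) (f 4) (f 5).

(** A plain fold over binary integers, so that [vm_compute] can evaluate it. *)
Definition sym_slack (c : triple_rel nat) : Z :=
  foldr Z.add Z0 [seq slack_at c (nth 0 s) | s <- perms6].

Lemma sym_slackE c : sym_slack c =
  (\sum_(s <- perms6) slack_at c (nth 0%N s))%R.
Proof. by rewrite /sym_slack foldrE big_map. Qed.

Lemma slack_at_pullback (S T : Type) (f : S -> T) (c : triple_rel T) g :
  slack_at (pullback f c) g = slack_at c (f \o g).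
Proof. by []. Qed.

Lemma uniq_perms6 : uniq perms6.
Proof. exact: permutations_uniq. Qed.

Lemma mem_perms6 s : (s \in perms6) = perm_eq s (iota 0 6).
Proof. exact: mem_permutations. Qed.

Lemma size_perms6 s : s \in perms6 -> size s = 6.
Proof. by rewrite mem_perms6 => /perm_size. Qed.

Lemma nth_perms6_lt s i : s \in perms6 -> nth 0 s i < 6.
Proof.
move=> sP; have [ilt|ige] := ltnP i (size s); last by rewrite nth_default.
have := mem_nth 0 ilt; move: sP; rewrite mem_perms6 => /perm_mem ->.
by rewrite mem_iota.
Qed.

Definition comp_seq (t s : seq nat) : seq nat := [seq nth 0 t i | i <- s].

Lemma nth_comp_seq t s i : i < size s ->
  nth 0 (comp_seq t s) i = nth 0 t (nth 0 s i).
Proof. by move=> ilt; rewrite (nth_map 0). Qed.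

Lemma comp_perms6 t s : t \in perms6 -> s \in perms6 -> comp_seq t s \in perms6.
Proof.
move=> tP; rewrite !mem_perms6 => sP.
apply: perm_trans (perm_map (nth 0 t) sP) _.
have -> : [seq nth 0 t i | i <- iota 0 6] = t
  by rewrite -(size_perms6 tP) map_nth_iota0 ?take_size.
by rewrite -mem_perms6.
Qed.

Lemma comp_seq_inj t : t \in perms6 -> {in perms6 &, injective (comp_seq t)}.
Proof.
move=> tP s1 s2 s1P s2P eqs; apply: (@eq_from_nth _ 0);
  first by rewrite !size_perms6.
move=> i ilt; have ilt2 : i < size s2 by move: ilt; rewrite !size_perms6.
have ut : uniq t by move: tP; rewrite mem_perms6 => /perm_uniq ->.
apply/eqP; rewrite -(nth_uniq 0 _ _ ut) ?(size_perms6 tP) ?nth_perms6_lt //.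
by rewrite -!nth_comp_seq // eqs.
Qed.

Lemma perm_comp_perms6 t : t \in perms6 ->
  perm_eq [seq comp_seq t s | s <- perms6] perms6.
Proof.
move=> tP.
have u : uniq [seq comp_seq t s | s <- perms6].
  by rewrite map_inj_in_uniq ?uniq_perms6; last exact: comp_seq_inj.
apply: (uniq_perm u uniq_perms6).
apply: (uniq_min_size u _ _).2; last by rewrite size_map.
by move=> s /mapP[s' s'P ->]; exact: comp_perms6.
Qed.

Definition agree6 (c d : triple_rel nat) :=
  forall i j k, i < 6 -> j < 6 -> k < 6 -> c i j k = d i j k.

Lemma slack_at_ext (c d : triple_rel nat) f g : agree6 c d ->
  (forall i, i < 6 -> f i < 6) -> (forall i, i < 6 -> f i = g i) ->
  slack_at c f = slack_at d g.
Proof.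
move=> cd flt fg; rewrite /slack_at -!fg //.
rewrite /slack /pair_part /quad_part /pairform1 /pairform2 /pairform3
  /pairform4.
rewrite /quadform1 /quadform2 /quadform3 /link_diff /link_cross.
by rewrite !cd ?flt.
Qed.

Lemma sym_slack_ext (c d : triple_rel nat) : agree6 c d ->
  sym_slack c = sym_slack d.
Proof.
move=> cd; rewrite !sym_slackE; apply: eq_big_seq => s sP.
by apply: slack_at_ext => // i _; exact: nth_perms6_lt.
Qed.

(** Relabelling by [t] only reorders the sum, since composition with [t] permutes [perms6]. *)
Lemma sym_slack_perm c t : t \in perms6 ->
  sym_slack (pullback (nth 0 t) c) = sym_slack c.
Proof.
move=> tP; rewrite !sym_slackE -[RHS](perm_big _ (perm_comp_perms6 tP)) big_map.
apply: eq_big_seq => s sP; rewrite slack_at_pullback.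
apply: slack_at_ext => [//|i _|i ilt]; first exact: nth_perms6_lt.
by rewrite nth_comp_seq ?size_perms6.
Qed.

(** * The symmetrised slack is nonnegative *)

(** Colexicographic order: the triples on the first labels form an initial segment, so restricting a
    pattern to fewer labels truncates its bit string. *)
Definition triples (n : nat) : seq (nat * nat * nat) :=
  [seq (p.1, p.2, k) | k <- iota 0 n,
                       p <- [seq (i, j) | j <- iota 0 k, i <- iota 0 j]].

Definition bits (n : nat) (c : triple_rel nat) : seq bool :=
  [seq c t.1.1 t.1.2 t.2 | t <- triples n].

(* The position 'C(k, 3) + 'C(j, 2) + i of (i, j, k) in [triples n]. *)
Definition rank (i j k : nat) : nat :=
  nth 0 [:: 0; 0; 0; 1; 4; 10] k + nth 0 [:: 0; 0; 1; 3; 6; 10] j + i.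

Definition bit_at (bs : seq bool) (i j k : nat) : bool :=
  nth false bs (rank i j k).

(** Arguments are sorted before the lookup and repeated ones give [false]. Positions past the end
    also read as [false], so a prefix decodes to the edges chosen so far. *)
Definition of_bits (bs : seq bool) : triple_rel nat := fun i j k =>
  if i < j then
    if j < k then bit_at bs i j k else
    if k < i then bit_at bs k i j else
    if i < k then if k < j then bit_at bs i k j else false else false
  else if j < i then
    if i < k then bit_at bs j i k else
    if k < j then bit_at bs k j i else
    if j < k then if k < i then bit_at bs j k i else false else false
  else false.

Lemma of_bits_cases bs c n i j k : free_rel c -> i < n -> j < n -> k < n ->
  (of_bits bs i j k = false /\ c i j k = false) \/
  exists a b d, [/\ a < b, b < d, d < n,
    of_bits bs i j k = bit_at bs a b d & c i j k = c a b d].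
Proof.
move=> cF iN jN kN; have s12 := free_rel12 cF; have s23 := free_rel23 cF.
have irr := free_rel_irr cF; rewrite /of_bits.
case: (ltngtP i j) => [ij|ji|<-]; last by left; rewrite irr.
- case: (ltngtP j k) => [jk|kj|jk]; first by right; exists i, j, k.
    case: (ltngtP k i) => [ki|ik|->]; last by left; rewrite s23 irr.
      by right; exists k, i, j; split; rewrite // s23 s12.
    by right; exists i, k, j; split; rewrite // s23.
  by left; rewrite -jk [c _ _ _]s12 [c _ _ _]s23 irr; case: ltngtP ij.
- case: (ltngtP i k) => [ik|ki|<-].
  + by right; exists j, i, k; split; rewrite // s12.
  + case: (ltngtP k j) => [kj|jk|->]; last by left; rewrite s12 s23 irr.
      by right; exists k, j, i; split; rewrite // s12 s23 s12.
    by right; exists j, k, i; split; rewrite // s12 s23.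
  + by left; rewrite s23 irr; case: ltngtP ji.
Qed.

Lemma nth_triples n i j k : n <= 6 -> i < j -> j < k -> k < n ->
  rank i j k < size (triples n) /\
  nth (0, 0, 0) (triples n) (rank i j k) = (i, j, k).
Proof.
move=> n6 ij jk kn.
have: all (fun n => all (fun k => all (fun j => all (fun i =>
    (rank i j k < size (triples n)) &&
    (nth (0, 0, 0) (triples n) (rank i j k) == (i, j, k)))
    (iota 0 j)) (iota 0 k)) (iota 0 n)) (iota 0 7) by vm_compute.
move=> /allP/(_ n); rewrite mem_iota => /(_ n6)/allP/(_ k).
rewrite mem_iota => /(_ kn)/allP/(_ j); rewrite mem_iota => /(_ jk)/allP/(_ i).
by rewrite mem_iota => /(_ ij)/andP[? /eqP].
Qed.

Lemma bit_at_bits n c i j k : n <= 6 -> i < j -> j < k -> k < n ->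
  bit_at (bits n c) i j k = c i j k.
Proof.
move=> n6 ij jk kn; have [lt eq] := nth_triples n6 ij jk kn.
by rewrite /bit_at (nth_map (0, 0, 0)) // eq.
Qed.

Lemma of_bitsK n c i j k : free_rel c -> n <= 6 -> i < n -> j < n -> k < n ->
  of_bits (bits n c) i j k = c i j k.
Proof.
move=> cF n6 iN jN kN; have [[-> ->] //|]
  := of_bits_cases (bits n c) cF iN jN kN.
by move=> [a [b [d [ab bd dn -> ->]]]]; rewrite bit_at_bits.
Qed.

Lemma of_bits_take m c i j k : free_rel c -> i < 6 -> j < 6 -> k < 6 ->
  of_bits (take m (bits 6 c)) i j k -> c i j k.
Proof.
move=> cF iN jN kN.
have [[-> //]|] := of_bits_cases (take m (bits 6 c)) cF iN jN kN.
move=> [a [b [d [ab bd dn -> ->]]]]; rewrite -(bit_at_bits c _ ab bd dn) //.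
rewrite /bit_at; have [lt|ge] := ltnP (rank a b d) m; first by rewrite nth_take.
by rewrite nth_default // size_take_min geq_min ge.
Qed.

Lemma bits_take n c : n <= 6 -> bits n c = take (size (triples n)) (bits 6 c).
Proof.
move=> n6; rewrite /bits -map_take; congr map.
have: all (fun n => triples n == take (size (triples n)) (triples 6))
  (iota 0 7).
  by vm_compute.
by move=> /allP/(_ n); rewrite mem_iota => /(_ n6)/eqP.
Qed.

Lemma mem_triples n t : t \in triples n -> [/\ t.1.1 < n, t.1.2 < n & t.2 < n].
Proof.
case/allpairsPdep => k [[i j] []]; rewrite mem_iota => kn.
case/allpairsPdep => j' [i' []]; rewrite !mem_iota => jk ij [-> ->] -> /=.
by split; lia.
Qed.

Lemma eq_bits n c d : n <= 6 -> agree6 c d -> bits n c = bits n d.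
Proof.
move=> n6 cd; apply/eq_in_map => t /mem_triples[t1 t2 t3].
by apply: cd; [exact: leq_trans n6 ..].
Qed.

(** * Comparison of bit strings and the pruning tests *)

Fixpoint bitval (bs : seq bool) : nat :=
  if bs is b :: bs' then b * 2 ^ size bs' + bitval bs' else 0.

Fixpoint bitlt (a b : seq bool) : bool :=
  match a, b with
  | x :: a', y :: b' => if x then if y then bitlt a' b' else false
                        else if y then true else bitlt a' b'
  | _, _ => false
  end.

Lemma bitval_lt bs : bitval bs < 2 ^ size bs.
Proof. elim: bs => //= b bs IH; rewrite expnS; case: b => /=; lia. Qed.

(** The first bit is the most significant, so a strict lexicographic inequality between prefixes
    decides the comparison whatever follows. *)
Lemma bitlt_cat a b x y : size a = size b -> size x = size y ->
  bitlt a b -> bitval (a ++ x) < bitval (b ++ y).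
Proof.
move=> + sxy; elim: a b => [|p a IH] [|q b] //= [sab].
have e : size (a ++ x) = size (b ++ y) by rewrite !size_cat sab sxy.
case: p q => [] [] //=; rewrite ?mul1n ?mul0n ?add0n.
- by move=> /(IH _ sab); rewrite e; lia.
- by move=> _; have := bitval_lt (a ++ x); rewrite e; lia.
- exact: IH.
Qed.

(* Tabulation: makes the evaluation of [c] on the six labels cheap. *)
Definition memo (c : triple_rel nat) : triple_rel nat :=
  let t := mkseq (fun i => mkseq (fun j => mkseq (c i j) 6) 6) 6 in
  fun i j k => nth false (nth [::] (nth [::] t i) j) k.

Lemma memoE c : agree6 (memo c) c.
Proof. by move=> i j k i6 j6 k6; rewrite /memo !nth_mkseq. Qed.

(* Nested conditionals instead of [&&], which would evaluate both arguments. *)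
Definition forbidden_in (n : nat) (c : triple_rel nat) : bool :=
  let has_vertex := fun p => has p (iota 0 n) in
  has_vertex (fun x => has_vertex (fun y => has_vertex (fun z =>
    if c x y z then has_vertex (fun w =>
      if c x y w then
        if c x z w then true
        else has_vertex (fun v => if c x y v then c z w v else false)
      else if c y z w then
        has_vertex (fun v => if c z w v then
          if c w v x then c v x y else false else false)
      else false)
    else false))).

(** The forbidden configurations ask only for the presence of edges, so one found in a subrelation
    [d] would also occur in [c]. *)
Lemma forbidden_inN n (c d : triple_rel nat) : free_rel c -> n <= 6 ->
  (forall i j k, i < 6 -> j < 6 -> k < 6 -> d i j k -> c i j k) ->
  forbidden_in n d = false.
Proof.
move=> cF n6 dc; apply/negP.
have lt i : i \in iota 0 n -> i < 6 by rewrite mem_iota => /leq_trans; exact.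
move=> /hasP[x /lt x6 /hasP[y /lt y6 /hasP[z /lt z6]]].
case: ifP => // /(dc _ _ _ x6 y6 z6) xyz /hasP[w /lt w6].
case: ifP => [/(dc _ _ _ x6 y6 w6) xyw|_].
  case: ifP => [/(dc _ _ _ x6 z6 w6) xzw _|_ /hasP[v /lt v6]].
    by rewrite (free_relK4 cF xyz xyw) in xzw.
  case: ifP => // /(dc _ _ _ x6 y6 v6) xyv /(dc _ _ _ z6 w6 v6).
  by rewrite (free_relF32 cF xyz xyw xyv).
case: ifP => // /(dc _ _ _ y6 z6 w6) yzw /hasP[v /lt v6].
case: ifP => // /(dc _ _ _ z6 w6 v6) zwv.
case: ifP => // /(dc _ _ _ w6 v6 x6) wvx /(dc _ _ _ v6 x6 y6).
by rewrite (free_relC5 cF xyz yzw zwv wvx).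
Qed.

Definition swap (i j k : nat) :
  nat := if k == i then j else if k == j then i else k.

Definition swaps (n : nat) : seq (seq nat) :=
  [seq mkseq (swap i j) 6 | j <- iota 0 n, i <- iota 0 j].

Lemma mem_swaps n t : n <= 6 -> t \in swaps n ->
  t \in perms6 /\ forall i, i < n -> nth 0 t i < n.
Proof.
move=> n6; have: all (fun n => all (fun t => perm_eq t (iota 0 6) &&
    all (fun i => nth 0 t i < n) (iota 0 n)) (swaps n)) (iota 0 7)
      by vm_compute.
move=> /allP/(_ n); rewrite mem_iota => /(_ n6)/allP H /H /andP[tP /allP lt].
by rewrite mem_perms6; split=> // i iN; apply: lt; rewrite mem_iota.
Qed.

Definition improvable (n : nat) (bs : seq bool) : bool :=
  let c := memo (of_bits bs) in
  has (fun t => bitlt (bits n (pullback (nth 0 t) c)) bs) (swaps n).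

(** The canonical representative of an orbit under relabelling. *)
Definition bit_minimal (c : triple_rel nat) : Prop :=
  forall t, t \in perms6 ->
    bitval (bits 6 c) <= bitval (bits 6 (pullback (nth 0 t) c)).

(** A transposition of the first [n] labels that lowers the prefix would lower the whole bit string,
    by [bitlt_cat], against minimality. *)
Lemma improvableN n c : free_rel c -> bit_minimal c -> n <= 6 ->
  improvable n (bits n c) = false.
Proof.
move=> cF cmin n6; apply/negP => /hasP[t /(mem_swaps n6)[tP tn]].
have -> : bits n (pullback (nth 0 t) (memo (of_bits (bits n c)))) =
          bits n (pullback (nth 0 t) c).
  apply/eq_in_map => u /mem_triples[u1 u2 u3];
    rewrite /pullback memoE ?nth_perms6_lt //.
  by rewrite (of_bitsK cF) ?tn.
set d := pullback _ c => lt; have := cmin t tP; rewrite leqNgt => /negP; apply.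
rewrite -/d -(cat_take_drop (size (triples n)) (bits 6 d)).
rewrite -[X in _ < bitval X](cat_take_drop (size (triples n)) (bits 6 c))
  -!bits_take //.
by apply: bitlt_cat lt; rewrite ?size_drop !size_map.
Qed.

(* Depth-first search over the last [r] bits of patterns on [n] labels, pruning
   forbidden patterns and patterns that a transposition makes smaller. *)
Fixpoint search (n r : nat) (bs : seq bool) (k : seq bool -> bool) : bool :=
  if r is r'.+1 then
    if search n r' (rcons bs false) k then
      if forbidden_in n (memo (of_bits (rcons bs true))) then true
      else search n r' (rcons bs true) k
    else false
  else if improvable n bs then true else k bs.

(** The branch that follows the bits of [c] survives both pruning tests, so a successful search has
    evaluated [k] at its leaf. *)
Lemma searchP n r bs k c : free_rel c -> bit_minimal c -> n <= 6 ->
  bs = take (size bs) (bits 6 c) -> size bs + r = size (triples n) ->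
  search n r bs k -> k (bits n c).
Proof.
move=> cF cmin n6; elim: r bs => [|r IH] bs ebs sz /=.
  have -> : bs = bits n c by rewrite bits_take // -sz addn0.
  by rewrite improvableN.
have lt : size bs < size (bits 6 c).
  have := congr1 size (bits_take c n6); rewrite size_take_min !size_map -sz;
    lia.
have eb : rcons bs (nth false (bits 6 c) (size bs)) =
  take (size bs).+1 (bits 6 c).
  by rewrite (take_nth false lt) -ebs.
case: ifP => // sF; case: (nth false _ _) eb => eb; last first.
  by move=> _; apply: IH sF; rewrite size_rcons ?addSnnS.
rewrite (forbidden_inN cF n6) => [|i j l i6 j6 l6].
  by apply: IH; rewrite size_rcons ?addSnnS.
by rewrite memoE // eb; exact: of_bits_take.
Qed.

(** Labels are added one at a time, so that [improvable] prunes after each of them; label number [n]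
    brings 'C(n - 1, 2) new triples, hence 1, 3, 6, 10. *)
Definition search_slack : bool :=
  search 3 1 [::] (fun b3 => search 4 3 b3 (fun b4 => search 5 6 b4 (fun b5 =>
    search 6 10 b5 (fun b6 => Z.leb 0 (sym_slack (memo (of_bits b6))))))).

Lemma search_slack_true : search_slack.
Proof. by vm_compute. Qed.

Lemma sym_slack_bit_minimal_ge0 c : free_rel c -> bit_minimal c ->
  Z.leb 0 (sym_slack c).
Proof.
move=> cF cmin.
have next n m r k : n <= 6 -> m <= 6 ->
  size (triples m) + r = size (triples n) ->
    search n r (bits m c) k -> k (bits n c).
  move=> n6 m6 sz; apply: (searchP cF cmin n6); rewrite ?size_map //.
  by rewrite -bits_take.
rewrite -(@sym_slack_ext (memo (of_bits (bits 6 c)))); last first.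
  by move=> i j k i6 j6 k6; rewrite memoE // of_bitsK.
have s3 := next 3 2 1 _ isT isT erefl search_slack_true.
have s4 := next 4 3 3 _ isT isT erefl s3.
have s5 := next 5 4 6 _ isT isT erefl s4.
exact: (next 6 5 10 _ isT isT erefl s5).
Qed.

(** Both freeness and [sym_slack] are invariant under relabelling, so [c] may be replaced by the
    pattern of least [bitval] in its orbit. *)
Lemma sym_slack_ge0 c : free_rel c -> Z.leb 0 (sym_slack c).
Proof.
move=> cF.
pose reach m := has (fun t => bitval (bits 6 (pullback (nth 0 t) c)) == m)
  perms6.
have exm : exists m, reach m.
  exists (bitval (bits 6 (pullback (nth 0 (iota 0 6)) c))); apply/hasP.
  by exists (iota 0 6) => //; rewrite mem_perms6.
have [m /hasP[t tP /eqP <-] mmin] := ex_minnP exm.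
rewrite -(sym_slack_perm c tP); apply: sym_slack_bit_minimal_ge0.
  exact: free_rel_pullback.
move=> s sP; rewrite (_ : bits 6 (pullback _ (pullback _ _)) =
    bits 6 (pullback (nth 0 (comp_seq t s)) c)).
  by apply: mmin; apply/hasP; exists (comp_seq t s); rewrite ?comp_perms6.
apply: eq_bits => // i j k i6 j6 k6.
by rewrite /pullback !nth_comp_seq ?size_perms6.
Qed.

(** * Summation over 6-tuples *)

(* The delimiter [%Z] denotes [int_scope] here. *)
Delimit Scope Z_scope with BZ.
Open Scope ring_scope.

Section SumSlack.
Variables (V : finType) (e : triple_rel V).

Let point (t : 6.-tuple V) (i : nat) : V := tnth t (inord i).

Let permute (s : seq nat) (t : 6.-tuple V) : 6.-tuple V :=
  [tuple point t (nth 0%N s i) | i < 6].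

Lemma point_permute s t (i : nat) : (i < 6)%N ->
  point (permute s t) i = point t (nth 0%N s i).
Proof. by move=> i6; rewrite /point tnth_mktuple inordK. Qed.

Lemma permute_inj s : s \in perms6 -> injective (permute s).
Proof.
move=> sP t1 t2 eqt; apply: eq_from_tnth => i.
have /(nthP 0%N)[j] : nat_of_ord i \in s.
  by move: sP; rewrite mem_perms6 => /perm_mem ->; rewrite mem_iota /=.
rewrite (size_perms6 sP) => j6 ji.
have := point_permute s t1 j6; rewrite eqt point_permute // ji /point.
by rewrite inord_val.
Qed.

(** Permuting coordinates is a bijection of the 6-tuples, so every permutation contributes the same
    total. *)
Lemma sum_sym_slack :
  \sum_t sym_slack (pullback (point t) e) =
  (\sum_t slack_at e (point t)) *+ size perms6.
Proof.
under eq_bigr do rewrite sym_slackE.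
rewrite exchange_big -iter_addr_0 -(count_predT perms6) -big_const_seq.
apply: eq_big_seq => s sP; rewrite [RHS](reindex_inj (permute_inj sP)) /=.
by apply: eq_bigr => t _; rewrite slack_at_pullback /slack_at !point_permute.
Qed.

Lemma sum_slack_at_ge0 : free_rel e -> 0 <= \sum_t slack_at e (point t).
Proof.
move=> eF; have perms6_gt0 : (0 < size perms6)%N.
  suff: iota 0 6 \in perms6 by case: perms6.
  by rewrite mem_perms6.
rewrite -(pmulrn_lge0 _ perms6_gt0) -sum_sym_slack sumr_ge0 // => t _.
exact/sym_slack_ge0/free_rel_pullback.
Qed.

Lemma sum_slack_at :
  \sum_t slack_at e (point t) =
  \sum_a \sum_p \sum_q slack e a.1 a.2 p.1 p.2 q.1 q.2.
Proof.
pose h (b : (V * V) * (V * V) * (V * V)) : 6.-tuple V :=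
  [tuple b.1.1.1; b.1.1.2; b.1.2.1; b.1.2.2; b.2.1; b.2.2].
pose g (t : 6.-tuple V) : (V * V) * (V * V) * (V * V) :=
  ((point t 0, point t 1, (point t 2, point t 3)), (point t 4, point t 5)).
have hE b : g (h b) = b.
  case: b => [[[x y] [z w]] [u v]].
  by rewrite /g /point /h /= !(tnth_nth x) /= !inordK.
have hb : bijective h.
  exists g => // t; apply: eq_from_tnth => i;
    rewrite -[i]inord_val (tnth_nth (point t 0)).
  by case: i => -[|[|[|[|[|[|//]]]]]] ? /=; rewrite inordK.
rewrite (reindex h); last exact: onW_bij.
rewrite pair_bigA pair_bigA /=; apply: eq_bigr => b _.
have := hE b; rewrite /g /slack_at; case: b => [[[x y] [z w]] [u v]] /=.
by case=> -> -> -> -> -> ->.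
Qed.

End SumSlack.

Lemma sum_mul_ge0 (I : finType) (g : I -> Z) : 0 <= \sum_i \sum_j g i * g j.
Proof.
have -> : \sum_i \sum_j g i * g j = (\sum_i g i) ^+ 2
  by rewrite expr2 big_distrlr.
exact: sqr_ge0.
Qed.

Section CountLinkedPairs.
Variables (V : finType) (e : triple_rel V).

Lemma sum_pair_part_ge0 x y :
  0 <= \sum_(p : V * V) \sum_(q : V * V) pair_part e x y p.1 p.2 q.1 q.2.
Proof.
pose F k (p : V * V) : Z :=
  nth 0 [:: pairform1 e x y p.1 p.2; pairform2 e x y p.1 p.2;
            pairform3 e x y p.1 p.2; pairform4 e x y p.1 p.2] k.
have -> : \sum_(p : V * V) \sum_(q : V * V) pair_part e x y p.1 p.2 q.1 q.2 =
    47%BZ * (\sum_p \sum_q F 0%N p * F 0%N q)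
    + 121%BZ * (\sum_p \sum_q F 1%N p * F 1%N q)
    + 13200%BZ * (\sum_p \sum_q F 2%N p * F 2%N q)
    + 69168%BZ * (\sum_p \sum_q F 3%N p * F 3%N q).
  rewrite !mulr_sumr -!big_split; apply: eq_bigr => p _.
  by rewrite !mulr_sumr -!big_split.
by rewrite !addr_ge0 // mulr_ge0 // sum_mul_ge0.
Qed.

Lemma sum_quad_part_ge0 x y z w :
  0 <= \sum_(q : V * V) quad_part e x y z w q.1 q.2.
Proof.
pose G k (u : V) : Z :=
  nth 0 [:: quadform1 e x y z w u; quadform2 e x y z w u;
            quadform3 e x y z w u] k.
rewrite -(pair_bigA _ (fun u v => quad_part e x y z w u v)) /=.
have -> : \sum_u \sum_v quad_part e x y z w u v =
    72600%BZ * (\sum_u \sum_v G 0%N u * G 0%N v)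
    + 7128%BZ * (\sum_u \sum_v G 1%N u * G 1%N v)
    + 18216%BZ * (\sum_u \sum_v G 2%N u * G 2%N v).
  rewrite !mulr_sumr -!big_split; apply: eq_bigr => u _.
  by rewrite !mulr_sumr -!big_split.
by rewrite !addr_ge0 // mulr_ge0 // sum_mul_ge0.
Qed.

(** The case [z = w] is allowed: this is a homomorphism count, which is bounded without lower-order
    terms. *)
Definition linked (b : (V * V) * (V * V)) : bool :=
  e b.1.1 b.1.2 b.2.1 && e b.1.1 b.1.2 b.2.2.

(** The squares enter [slack] with a minus sign and are dropped: those of [quad_part] when summing
    over [(u, v)] in [inner], those of [pair_part] when summing over [(z, w)] in [outer]. *)
Lemma sum_slack_le :
  \sum_a \sum_p \sum_q slack e a.1 a.2 p.1 p.2 q.1 q.2 <=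
  (69696%BZ * (#|V| ^ 4)%:R - 940896%BZ * #|[pred b | linked b]|%:R)
    * (#|V| ^ 2)%:R.
Proof.
have cardV2 : #|{: V * V}| = (#|V| ^ 2)%N by rewrite card_prod.
set m : Z := (#|V| ^ 2)%:R.
have sum_const (k : Z) : \sum_(q : V * V) k = k * m.
  by rewrite sumr_const cardV2 -mulr_natr.
have slackE x y z w u v : slack e x y z w u v =
    69696%BZ - 9%BZ * pair_part e x y z w u v -
    (if linked ((x, y), (z, w))
     then 940896%BZ + 9%BZ * quad_part e x y z w u v else 0).
  by [].
have inner a p : \sum_q slack e a.1 a.2 p.1 p.2 q.1 q.2 <=
    69696%BZ * m - 9%BZ * (\sum_q pair_part e a.1 a.2 p.1 p.2 q.1 q.2)
    - 940896%BZ * m * (linked (a, p))%:R.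
  case: a p => [x y] [z w] /=; under eq_bigr do rewrite slackE.
  rewrite !sumrB -mulr_sumr sum_const lerB //.
  case: (linked _); last by rewrite big1 ?mulr0.
  rewrite big_split -mulr_sumr sum_const mulr1 lerDl mulr_ge0 //.
  exact: sum_quad_part_ge0.
have outer a : \sum_p \sum_q slack e a.1 a.2 p.1 p.2 q.1 q.2 <=
    69696%BZ * m * m - 940896%BZ * m * \sum_p (linked (a, p))%:R.
  apply: le_trans; first by apply: ler_sum => p _; exact: inner.
  rewrite !sumrB sum_const -!mulr_sumr lerB //.
  by rewrite gerBl mulr_ge0 // sum_pair_part_ge0.
apply: le_trans; first by apply: ler_sum => a _; exact: outer.
rewrite sumrB sum_const -mulr_sumr pair_bigA -natr_sum.
have -> : (\sum_p linked p = #|[pred b | linked b]|)%N.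
  by rewrite -sum1_card [RHS]big_mkcond; apply: eq_bigr => b _; rewrite inE;
    case: linked.
rewrite (_ : #|V| ^ 4 = #|V| ^ 2 * #|V| ^ 2)%N ?natrM -/m;
  last by rewrite -expnD.
by rewrite le_eqVlt; apply/orP; left; apply/eqP; ring.
Qed.

Theorem card_linked_le : free_rel e ->
  (27 * #|[pred b | linked b]| <= 2 * #|V| ^ 4)%N.
Proof.
(* The factor [#|V| ^ 2] is to be cancelled, so the empty vertex set is treated apart. *)
move=> eF; have [V0|V_gt0] := posnP #|V|.
  rewrite eq_card0 // => -[[x y] p]; have := max_card (pred1 x).
  by rewrite V0 card1.
have := le_trans (sum_slack_at_ge0 eF) _;
  rewrite sum_slack_at => /(_ _ sum_slack_le).
rewrite pmulr_lge0 ?ltr0n ?expn_gt0 ?V_gt0 // subr_ge0.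
have natE (k : nat) : k%:R = Z.of_nat k by elim: k => // k IH;
  rewrite mulrS IH; lia.
by rewrite !natE; lia.
Qed.

End CountLinkedPairs.

Close Scope ring_scope.

(** * The upper bound for 3-graphs *)

Lemma imset3 (S T : finType) (f : S -> T) (x y z : S) :
  f @: [set x; y; z] = [set f x; f y; f z].
Proof. by rewrite !imsetU !imset_set1. Qed.

Lemma cards3_uniq (T : finType) (x y z : T) :
  (#|[set x; y; z]| == 3) = uniq [:: x; y; z].
Proof.
have -> : #|[set x; y; z]| = #|[:: x; y; z]|.
  by apply: eq_card => u; rewrite !inE orbA.
by apply/eqP/idP => [/card_uniqP//|/card_uniqP].
Qed.

Section EdgeRel.
Variables (V : finType) (G : three_graph V).

Definition edge_rel : triple_rel V := fun x y z => [set x; y; z] \in edges G.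

Lemma card_edge (A : {set V}) : A \in edges G -> #|A| = 3.
Proof. by case: G => E /= /forall_inP EP /EP/eqP. Qed.

Lemma edge_rel_uniq x y z : edge_rel x y z -> uniq [:: x; y; z].
Proof. by move=> /card_edge/eqP; rewrite cards3_uniq. Qed.

Lemma edge_rel_neq x y z : edge_rel x y z -> [/\ x != y, x != z & y != z].
Proof.
move=> /edge_rel_uniq; rewrite /= !inE negb_or => /andP[/andP[-> ->]
  /andP[-> _]].
by [].
Qed.

Lemma contains_of_triples n s (ok : all (@triple_ok n) s) (f : 'I_n.+1 -> V) :
  injective f ->
  all (fun t => edge_rel (f (inord t.1.1.-1)) (f (inord t.1.2.-1))
                         (f (inord t.2.-1))) s ->
  contains G (of_triples ok).
Proof.
move=> fI /allP sG; exists f => // A; rewrite inE => /mapP[[[a b] d] ts ->].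
by rewrite /= imset3; exact: sG ts.
Qed.

Lemma tuple_inj n (t : n.-tuple V) : uniq t -> injective (tnth t).
Proof. by move=> /tuple_uniqP. Qed.

(** A violated axiom gives an embedded forbidden graph: any two of its vertices lie in a common
    edge, hence are distinct. *)
Lemma edge_rel_free : family_free forbidden G -> free_rel edge_rel.
Proof.
move=> Gfree.
have s12 x y z : edge_rel x y z = edge_rel y x z.
  by rewrite /edge_rel (finset.setUC [set x]).
have s23 x y z : edge_rel x y z = edge_rel x z y.
  by rewrite /edge_rel finset.setUAC.
have tn n (t : n.+1.-tuple V) i x0 : i < n.+1 -> tnth t (inord i) = nth x0 t i.
  by move=> ilt; rewrite (tnth_nth x0) inordK.
split=> //.
- by move=> x y; apply/negP => /edge_rel_uniq; rewrite /= inE eqxx.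
- move=> x y z w xyz xyw; apply/negP => xzw.
  apply: (Gfree 4 K4minus); first by left; left.
  apply: (@contains_of_triples _ _ _ (tnth [tuple x; y; z; w])).
    apply: tuple_inj; move: (edge_rel_neq xyz) (edge_rel_neq xyw)
      (edge_rel_neq xzw).
    by rewrite /= !inE !negb_or => -[-> -> ->] [_ -> ->] [_ _ ->].
  by rewrite /= !(tn _ _ _ x) //= xyz xyw xzw.
- move=> x y z w v xyz yzw zwv wvx; apply/negP => vxy.
  apply: (Gfree 5 C5); first by left; right.
  apply: (@contains_of_triples _ _ _ (tnth [tuple x; y; z; w; v])).
    apply: tuple_inj; move: (edge_rel_neq xyz) (edge_rel_neq yzw)
      (edge_rel_neq zwv) (edge_rel_neq wvx) (edge_rel_neq vxy).
    rewrite /= !inE !negb_or => -[-> -> ->] [_ -> ->] [_ ->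
      ->] [_ wx vx] [_ vy _].
    by rewrite (eq_sym x w) wx (eq_sym x v) vx (eq_sym y v) vy.
  by rewrite /= !(tn _ _ _ x) //= xyz yzw zwv wvx vxy.
- move=> x y z w v xyz xyw xyv; apply/negP => zwv.
  apply: (Gfree 5 F32); first by right.
  apply: (@contains_of_triples _ _ _ (tnth [tuple x; y; z; w; v])).
    apply: tuple_inj; move: (edge_rel_neq xyz) (edge_rel_neq xyw)
      (edge_rel_neq xyv) (edge_rel_neq zwv).
    by rewrite /= !inE !negb_or => -[-> -> ->] [_ -> ->] [_ -> ->] [-> -> ->].
  by rewrite /= !(tn _ _ _ x) //= xyz xyw xyv zwv.
Qed.

Definition support (b : (V * V) * (V * V)) : {set V} :=
  [set b.1.1; b.1.2; b.2.1; b.2.2].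

Lemma linked_of_induced (S : {set V}) : isomorphic G42 (Defs.induced G S) ->
  exists x y z w, [/\ x != y, z != w, linked edge_rel ((x, y), (z, w)) &
    S = support ((x, y), (z, w))].
Proof.
case=> f fbij fG; pose g i := val (f i).
have fI := bij_inj fbij.
have gI : injective g by move=> i j /val_inj/fI.
have gG a b d : (a, b, d) \in [:: (1, 2, 3); (1, 2, 4)] ->
    edge_rel (g (inord a.-1)) (g (inord b.-1)) (g (inord d.-1)).
  move=> abd; have : triple 3 (a, b, d) \in edges G42 by rewrite inE map_f.
  by rewrite fG inE -imset_comp /= imset3.
exists (g (inord 0)), (g (inord 1)), (g (inord 2)), (g (inord 3)).
split; rewrite ?(inj_eq gI) -?val_eqE /= ?inordK //.
  by rewrite /linked /= (gG 1 2 3) ?(gG 1 2 4).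
apply/setP => v; rewrite !inE; apply/idP/idP.
  move=> vS; have [h hK Kh] := fbij;
    have : v = g (h (Sub v vS)) by rewrite /g Kh.
  case: (h _) => i i4 ->; rewrite !(inj_eq gI) -!val_eqE /= !inordK //.
  by case: i i4 => [|[|[|[|]]]].
by case/orP => [/orP[/orP[]|]|] /eqP ->; exact: valP.
Qed.

(** Exchanging [x], [y] and exchanging [z], [w] gives four linked quadruples with the same support;
    quadruples are grouped by support. *)
Lemma num_induced_G42_le :
  4 * num_induced G42 G <= #|[pred b | linked edge_rel b]|.
Proof.
rewrite mulnC /num_induced -sum_nat_const -sum1_card.
rewrite (partition_big support predT) //= big_mkcond; apply: leq_sum => S _.
case: ifP => //; rewrite inE => /andP[_ /asboolP/linked_of_induced].
case=> x [y [z [w [xy zw lk ->]]]]; rewrite sum1_card.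
pose s := [:: ((x, y), (z, w)); ((y, x), (z, w)); ((x, y), (w, z));
  ((y, x), (w, z))].
have us : uniq s.
  by rewrite /s /= !inE !xpair_eqE !eqxx !(eq_sym y) !(eq_sym w) (negPf xy)
    (negPf zw).
rewrite -[leqLHS]/(size s) -(card_uniqP us) subset_leq_card //.
have [l1 l2] : edge_rel x y z /\ edge_rel x y w by move: lk => /andP[].
have [l3 l4] : edge_rel y x z /\ edge_rel y x w.
  by rewrite /edge_rel (finset.setUC [set y]).
apply/fintype.subsetP => b; rewrite !inE => /or4P[]/eqP ->;
  rewrite unfold_in inE /linked /= ?l1 ?l2 ?l3 ?l4 /=;
  by apply/eqP/setP => v; rewrite !inE /=;
  case: (v == x) (v == y) (v == z) (v == w) => [] [] [] [].
Qed.

End EdgeRel.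

(** With [T] linked quadruples, 27 * 4 * e <= 27 * T <= 2 * n ^ 4, which gives the factor 54. *)
Lemma ex_num_le n : 54 * ex_num G42 n forbidden <= n ^ 4.
Proof.
rewrite mulnC -leq_divRL //; apply/bigmax_leqP => G /asboolP/edge_rel_free GF.
rewrite leq_divRL //; have := card_linked_le GF; rewrite card_ord.
have := num_induced_G42_le G; lia.
Qed.

(** * The complete tripartite 3-graph *)

Lemma cards4_uniq (T : finType) (x y z w : T) :
  uniq [:: x; y; z; w] -> #|[set x; y; z; w]| = 4.
Proof.
move=> /card_uniqP u; rewrite -[RHS]u; apply: eq_card => v.
by rewrite !inE -!orbA.
Qed.

Lemma isomorphic_G42 (V : finType) (G : three_graph V) x y z w :
  uniq [:: x; y; z; w] -> edge_rel G x y z -> edge_rel G x y w ->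
  ~~ edge_rel G x z w -> ~~ edge_rel G y z w ->
  isomorphic G42 (Defs.induced G [set x; y; z; w]).
Proof.
move=> u4 xyz xyw nxzw nyzw; set S := [set x; y; z; w].
pose g := tnth [tuple x; y; z; w].
have gS i : g i \in S by case: i => -[|[|[|[|//]]]] ?;
  rewrite /g !inE (tnth_nth x) /= eqxx ?orbT.
have gI : injective g by apply: tuple_inj.
pose f i : {v : V | v \in S} := Sub (g i) (gS i).
have fI : injective f by move=> i j /(congr1 val)/gI.
have cS : #|S| = 4 by rewrite cards4_uniq.
exists f; first by apply: inj_card_bij; rewrite // card_sig card_ord cS.
move=> A; rewrite [RHS]inE -imset_comp -[val \o f]/g.
have [A3|nA3] := eqVneq #|A| 3; last first.
  rewrite (negbTE (_ : A \notin _)); last by apply: contra nA3 => /card_edge ->.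
  by apply/esym/negbTE; apply: contra nA3 => /card_edge;
    rewrite card_imset // => ->.
(* A 3-subset of four labels is the complement of a single label, which leaves four cases. *)
have /cards1P[i Ai] : #|~: A| == 1 by rewrite cardsCs finset.setCK card_ord A3.
have gE k : k < 4 -> g (inord k) = nth x [:: x; y; z; w] k.
  by move=> k4; rewrite /g (tnth_nth x) inordK.
have {}Ai : A = ~: [set i] by rewrite -Ai finset.setCK.
have AE k a b d : k < 4 -> a < 4 -> b < 4 -> d < 4 ->
    (forall j, j < 4 -> (j != k) = [|| j == a, j == b | j == d]) ->
    ~: [set inord k : 'I_4] = [set inord a; inord b; inord d].
  move=> k4 a4 b4 d4 E; apply/setP => -[j j4].
  by rewrite !inE -!val_eqE /= !inordK // E // orbA.
have iE : i = inord i by rewrite inord_val.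
have o4 k l : k < 4 -> l < 4 -> (inord k == inord l :> 'I_4) = (k == l).
  by move=> k4 l4; rewrite -val_eqE /= !inordK.
rewrite inE /= !inE {}Ai iE.
case: i {iE} => -[|[|[|[|//]]]] ? /=.
- rewrite (AE 0 1 2 3) //; last by case=> [|[|[|[|]]]].
  rewrite imset3 !gE // [RHS](negbTE nyzw); apply/negbTE.
  by rewrite negb_or; apply/andP; split; apply/eqP => /setP/(_ (inord 0));
    rewrite !inE !o4.
- rewrite (AE 1 0 2 3) //; last by case=> [|[|[|[|]]]].
  rewrite imset3 !gE // [RHS](negbTE nxzw); apply/negbTE.
  by rewrite negb_or; apply/andP; split; apply/eqP => /setP/(_ (inord 1));
    rewrite !inE !o4.
- rewrite (AE 2 0 1 3) //; last by case=> [|[|[|[|]]]].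
  by rewrite imset3 !gE // [RHS]xyw eqxx orbT.
- rewrite (AE 3 0 1 2) //; last by case=> [|[|[|[|]]]].
  by rewrite imset3 !gE // [RHS]xyz eqxx.
Qed.

Section Tripartite.
Variable n : nat.

(** The three parts are the residue classes modulo 3. *)
Definition rainbow (A : {set 'I_n}) : bool :=
  [forall x in A, forall y in A, (x == y %[mod 3]) ==> (x == y)].

Lemma tripartite_edgesP :
  [forall A in [set A : {set 'I_n} | (#|A| == 3) && rainbow A], #|A| == 3].
Proof. by apply/forall_inP => A; rewrite inE => /andP[]. Qed.

Definition tripartite : three_graph 'I_n := ThreeGraph tripartite_edgesP.

Lemma edge_rel_tripartite (x y z : 'I_n) :
  edge_rel tripartite x y z = uniq [:: x %% 3; y %% 3; z %% 3].
Proof.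
rewrite /edge_rel inE cards3_uniq; apply/andP/idP => [[u /forall_inP A]|u].
  have col v w : v \in [set x; y; z] -> w \in [set x; y;
    z] -> v != w -> v %% 3 != w %% 3.
    by move=> /A/forall_inP vA /vA /implyP vw; apply: contra.
  move: u; rewrite /= !inE !negb_or => /andP[/andP[xy xz] /andP[yz _]].
  by rewrite !col // !inE eqxx ?orbT.
have col : {in [set x; y; z] &, forall v w : 'I_n, v %% 3 = w %% 3 -> v = w}.
  move: u; rewrite /= !inE !negb_or => /andP[/andP[xy xz] /andP[yz _]].
  by move=> v w; rewrite !inE => /orP[/orP[]|] /eqP -> /orP[/orP[]|] /eqP ->
    // /eqP;
    rewrite ?(negbTE xy) ?(negbTE xz) ?(negbTE yz) // eq_sym
      ?(negbTE xy) ?(negbTE xz) ?(negbTE yz).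
split; first by apply: (@map_uniq _ _ (fun v : 'I_n => v %% 3)).
apply/forall_inP => v vA; apply/forall_inP => w wA; apply/implyP => /eqP vw.
by apply/eqP; exact: col.
Qed.

Lemma tripartite_colouring m s (ok : all (@triple_ok m) s) :
  contains tripartite (of_triples ok) ->
  exists2 col : nat -> nat, (forall i, col i < 3) &
    all (fun t => uniq [:: col t.1.1; col t.1.2; col t.2]) s.
Proof.
case=> f _ fG; exists (fun i => f (inord i.-1) %% 3) => [i|];
  first by rewrite ltn_mod.
apply/allP => -[[a b] d] abd; have := fG (triple m (a, b, d)).
by rewrite inE map_f // imset3 => /(_ isT); rewrite -edge_rel_tripartite.
Qed.

(** Any two vertices of a forbidden graph share an edge, so they would all need different colours;
    but there are at least four vertices and only three colours. *)
Lemma tripartite_free : family_free forbidden tripartite.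
Proof.
move=> k F FF.
suff : ~ contains tripartite (tagged (member F)) by [].
case: FF => [[|]|] -> /tripartite_colouring[col c3] /=; rewrite !inE;
  have := c3 1; have := c3 2; have := c3 3; have := c3 4; have := c3 5; lia.
Qed.

Let m := n %/ 3.

Lemma blow_subproof (p : 'I_3 * 'I_m) : p.2 * 3 + p.1 < n.
Proof. case: p => [[d d3] [a am]] /=; move: am; rewrite /m; lia. Qed.

(** Selects exactly [m] vertices in each residue class, leaving out at most two vertices. *)
Let blow (p : 'I_3 * 'I_m) : 'I_n := Ordinal (blow_subproof p).

Lemma blow_inj : injective blow.
Proof.
move=> [[d d3] [a am]] [[d' d3'] [a' am']] /(congr1 val)/= eq.
by congr (_, _); apply/val_inj => /=; lia.
Qed.

Lemma blow_mod p : blow p %% 3 = p.1.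
Proof. by rewrite /= modnMDl modn_small. Qed.

(** Places [A] in class [c] and one vertex in each of the classes [c + 1] and [c + 2], taken modulo
    3. *)
Let layers (q : 'I_3 * {set 'I_m} * 'I_m * 'I_m) : {set 'I_3 * 'I_m} :=
  let: (c, A, k, l) := q in
  [set p | if p.1 == c then p.2 \in A
           else if p.1 == (c + 1)%R then p.2 == k else p.2 == l].

Let profiles := [set q : 'I_3 * {set 'I_m} * 'I_m * 'I_m | #|q.1.1.2| == 2].

Lemma layers_inj : {in profiles &, injective layers}.
Proof.
have c12 (c : 'I_3) : [/\ (c + 1 == c)%R = false, (c + 2 == c)%R = false
    & (c + 2 == c + 1)%R = false].
  by case: c => -[|[|[|//]]] ?.
(* Slice sizes recover the doubled class [c]: it is the only one met in two vertices. *)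
have cardL (d : 'I_3) q : #|[set a | (d, a) \in layers q]| =
    if d == q.1.1.1 then #|q.1.1.2| else 1.
  case: q => [[[c A] k] l] /=; case: ifP => dc.
    by apply: eq_card => a; rewrite !inE dc.
  rewrite -[RHS](cards1 (if (d == c + 1)%R then k else l)); apply: eq_card => a.
  by rewrite !inE dc; case: ifP.
move=> q q'; rewrite !inE => /eqP A2 /eqP A2' eqL.
have ec : q.1.1.1 = q'.1.1.1.
  apply/eqP; have := cardL q.1.1.1 q; rewrite eqxx A2 eqL cardL.
  by case: eqP.
case: q q' A2 A2' eqL ec => [[[c A] k] l] [[[c' A'] k'] l'] /= _ _ + ec.
rewrite -{c'}ec => /setP eqL.
have [e1 e2 e12] := c12 c.
congr (_, _, _, _).
- by apply/setP => a; have := eqL (c, a); rewrite !inE /= eqxx.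
- by have := eqL ((c + 1)%R, k); rewrite !inE /= e1 !eqxx => /esym/eqP.
- by have := eqL ((c + 2)%R, l); rewrite !inE /= e2 e12 !eqxx => /esym/eqP.
Qed.

Lemma num_induced_tripartite :
  3 * 'C(m, 2) * m * m <= num_induced G42 tripartite.
Proof.
have <- : #|profiles| = 3 * 'C(m, 2) * m * m.
  have -> : profiles = finset.setX (finset.setX (finset.setX [set:
    'I_3] [set A : {set 'I_m} | #|A| == 2]) [set: 'I_m]) [set: 'I_m].
    by apply/setP => -[[[c A] k] l]; rewrite !inE /= !andbT.
  by rewrite !finset.cardsX !cardsT !card_ord card_draws card_ord.
have inj : {in profiles &, injective (fun q => blow @: layers q)}.
  by move=> q q' qQ qQ' /(imset_inj blow_inj); exact: layers_inj.
rewrite -(card_in_imset inj) subset_leq_card //.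
apply/fintype.subsetP => _ /imsetP[[[[c A] k] l] + ->];
  rewrite !inE /= => /cards2P[a [b [ab ->]]].
(* The single vertices [x], [y] form the common pair of the two edges; [z], [w] lie in one class, so
   no edge contains both. *)
pose x := blow ((c + 1)%R, k); pose y := blow ((c + 2)%R, l).
pose z := blow (c, a); pose w := blow (c, b).
have -> : blow @: layers (c, [set a; b], k, l) = [set x; y; z; w].
  rewrite (_ : layers _ = [set ((c + 1)%R, k); ((c + 2)%R, l); (c, a); (c, b)]).
    by rewrite !imsetU !imset_set1.
  apply/setP => -[d i]; rewrite !inE /= !xpair_eqE.
  by case: c d {x y z w} => -[|[|[|//]]] ? [[|[|[|//]]] ?];
    rewrite -!val_eqE /= ?orbF ?orbT.
have u : uniq [:: x; y; z; w].
  rewrite /x /y /z /w (map_inj_uniq blow_inj [:: _; _; _;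
    _]) /= !inE !xpair_eqE /= eqxx (negbTE ab).
  by case: c {x y z w} => -[|[|[|//]]] ?.
have iso : isomorphic G42 (Defs.induced tripartite [set x; y; z; w]).
  apply: isomorphic_G42 => //;
    rewrite !edge_rel_tripartite /x /y /z /w !blow_mod;
  by case: c {x y z w u} => -[|[|[|//]]] ?.
by rewrite cards4_uniq //=; apply/asboolP.
Qed.

Lemma ex_num_ge : 3 * 'C(m, 2) * m * m <= ex_num G42 n forbidden.
Proof.
apply: leq_trans num_induced_tripartite _.
by apply: leq_bigmax_cond; apply/asboolP; exact: tripartite_free.
Qed.
End Tripartite.

(** * The limit *)

Lemma bin4_ffact n : 'C(n, 4) * 24 = n * n.-1 * n.-2 * n.-2.-1.
Proof. by rewrite -[24]/(4`!) bin_ffact !ffactnS ffactn0 muln1 !mulnA. Qed.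

Lemma bin4_le n : 'C(n, 4) * 24 <= n ^ 4.
Proof.
rewrite bin4_ffact (_ : n ^ 4 = n * n * n * n);
  last by rewrite !expnS expn0 muln1 !mulnA.
by rewrite !leq_mul //; lia.
Qed.

Lemma bin4_ge n : (n - 3) ^ 4 <= 'C(n, 4) * 24.
Proof.
rewrite bin4_ffact (_ : (n - 3) ^ 4 = (n - 3) * (n - 3) * (n - 3) * (n - 3)).
  by rewrite !leq_mul //; lia.
by rewrite !expnS expn0 muln1 !mulnA.
Qed.

(** As n <= 3 * m + 2, the truncated n - 5 is at most 3 * (m - 1); and 54 * 3 / 2 = 81 = 3 ^ 4. *)
Lemma ex_num_ge_pow n : (n - 5) ^ 4 <= 54 * ex_num G42 n forbidden.
Proof.
apply: leq_trans (leq_mul (leqnn 54) (ex_num_ge n)).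
set m := n %/ 3; have -> :
  54 * (3 * 'C(m, 2) * m * m) = 81 * (m * m.-1 * m * m).
  by rewrite -[m * m.-1](_ : 'C(m, 2) * 2 = _);
    [lia | rewrite -[2]/(2`!) bin_ffact !ffactnS ffactn0 muln1].
apply: (@leq_trans ((3 * m.-1) ^ 4)); first by rewrite leq_exp2r // /m; lia.
rewrite expnMn leq_mul // (_ : m.-1 ^ 4 = m.-1 * m.-1 * m.-1 * m.-1).
  by rewrite !leq_mul // leq_pred.
by rewrite !expnS expn0 muln1 !mulnA.
Qed.

Local Open Scope ring_scope.
Local Open Scope classical_set_scope.

Section Limit.
Variable R : realType.

Lemma cvg_harmonic_affine_exp (a : R) k :
  (1 - a * harmonic n) ^+ k @[n --> \oo] --> (1 : R).
Proof.
have cvg1 : 1 - a * harmonic n @[n --> \oo] --> (1 : R).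
  rewrite -[X in _ --> X](_ : 1 - a * 0 = 1); last by rewrite mulr0 subr0.
  apply: cvgB; first exact: cvg_cst.
  by apply: cvgM; [exact: cvg_cst | exact: cvg_harmonic].
rewrite -[X in _ --> X](expr1n _ k).
apply: (@cvg_comp _ _ _ _ (fun x : R => x ^+ k) _ _ _ cvg1).
exact: exprn_continuous.
Qed.

(** Stated at [n.+1] because [harmonic n] is 1 / (n + 1). The constant is 4 / 9 = 24 / 54, with 24
    from 'C(N, 4) ~ N ^ 4 / 24 and 54 from the bounds on [ex_num]. *)
Lemma ex_ratio_bounds n : (6 <= n)%N ->
  4 / 9 * (1 - 5 * harmonic n) ^+ 4 <= ex_ratio R G42 forbidden n.+1 <=
  4 / 9 * ((1 - 3 * harmonic n) ^+ 4)^-1.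
Proof.
move=> n6; rewrite /ex_ratio /harmonic /=.
set A := ex_num _ _ _; set C := 'C(_, _); set N : R := n.+1%:R.
have N_gt6 : 6 < N by rewrite ltr_nat.
have N_neq0 : N != 0 by rewrite gt_eqF //; lra.
have C_gt0 : 0 < C%:R :> R by rewrite ltr0n bin_gt0; lia.
have A_le : 54 * A%:R <= N ^+ 4 by rewrite -natrM -natrX ler_nat ex_num_le.
have C_le : C%:R * 24 <= N ^+ 4 by rewrite -natrM -natrX ler_nat bin4_le.
have C_ge : (N - 3) ^+ 4 <= C%:R * 24.
  (* The lower bound on [n] makes the truncated subtraction of naturals agree with that of reals. *)
  by rewrite -natrB; [rewrite -natrM -natrX ler_nat bin4_ge | lia].
have A_ge : (N - 5) ^+ 4 <= 54 * A%:R.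
  by rewrite -natrB; [rewrite -natrM -natrX ler_nat ex_num_ge_pow | lia].
have -> : 1 - 5 * N^-1 = (N - 5) / N by field.
have -> : 1 - 3 * N^-1 = (N - 3) / N by field.
have N4 : 0 < N ^+ 4 by rewrite exprn_gt0 //; lra.
have N34 : 0 < (N - 3) ^+ 4 by rewrite exprn_gt0 //; lra.
rewrite !expr_div_n invf_div; apply/andP; split.
  rewrite mulrA ler_pdivlMr // mulrAC ler_pdivrMr //.
  have : (N - 5) ^+ 4 * (C%:R * 24) <= (54 * A%:R) * N ^+ 4.
    by rewrite ler_pM // ?exprn_ge0 ?mulr_ge0 //; lra.
  lra.
rewrite mulrA ler_pdivrMr // mulrAC ler_pdivlMr //.
have : (54 * A%:R) * (N - 3) ^+ 4 <= N ^+ 4 * (C%:R * 24).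
  by apply: ler_pM => //; exact: ltW.
lra.
Qed.

Lemma cvg_ex_ratio : ex_ratio R G42 forbidden n @[n --> \oo] --> (4 / 9 : R).
Proof.
rewrite -cvg_shiftS /=.
apply: (@squeeze_cvgr _ _ _ _ (fun n => 4 / 9 * (1 - 5 * harmonic n) ^+ 4)
  (fun n => 4 / 9 * ((1 - 3 * harmonic n) ^+ 4)^-1)).
- by exists 6%N => // n /=; exact: ex_ratio_bounds.
- rewrite -[X in _ --> X]mulr1; apply: cvgM; first exact: cvg_cst.
  exact: cvg_harmonic_affine_exp.
- rewrite -[X in _ --> X](_ : 4 / 9 * 1^-1 = 4 / 9);
  last by rewrite invr1 mulr1.
  apply: cvgM; first exact: cvg_cst.
  by apply: cvgV; rewrite ?oner_eq0 //; exact: cvg_harmonic_affine_exp.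
Qed.

End Limit.

Local Close Scope classical_set_scope.

Theorem theorem2p19 (R : realType) :
  cvgn (ex_ratio R G42 forbidden) /\
  turan_density R G42 forbidden = 4%:R / 9%:R.
Proof.
split; first by apply/cvg_ex; exists (4 / 9); exact: cvg_ex_ratio.
by rewrite /turan_density; apply: cvg_lim => //; exact: cvg_ex_ratio.
Qed.
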